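(* Let $q$ be a prime power. The number of equivalence classes, under dynamical equivalence, of the dynamical systems $(\mathbb{F}_q, x\mapsto ax+b)$ with $a\in\mathbb{F}_q^*$ and $b\in\mathbb{F}_q$ is equal to $\tau(q-1)+1$, where $\tau(q-1)$ is the number of distinct positive divisors of $q-1$.
   Context: Two dynamical systems $(\mathbb{S},f)$ and $(\mathbb{T},g)$ (maps $f:\mathbb{S}\to\mathbb{S}$, $g:\mathbb{T}\to\mathbb{T}$) are dynamically equivalent if there is a bijection $\sigma:\mathbb{S}\to\mathbb{T}$ with $\sigma^{-1}\circ g\circ\sigma=f$. $\mathbb{F}_q^*=\mathbb{F}_q\setminus\{0\}$. *)

(* Defs.v *)
From mathcomp Require Import all_boot all_algebra.
From mathcomp Require Import boolp.

Set Implicit Arguments.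
Unset Strict Implicit.
Unset Printing Implicit Defensive.

Import GRing.Theory.
Local Open Scope ring_scope.

Definition dyn_equiv (S T : Type) (f : S -> S) (g : T -> T) : Prop :=
  exists (sigma : S -> T) (sigmaV : T -> S),
    [/\ cancel sigma sigmaV, cancel sigmaV sigma
      & sigmaV \o g \o sigma =1 f].

Lemma dyn_equiv_refl (S : Type) (f : S -> S) : dyn_equiv f f.
Proof. by exists id, id. Qed.

Lemma dyn_equiv_sym (S T : Type) (f : S -> S) (g : T -> T) :
  dyn_equiv f g -> dyn_equiv g f.
Proof.
move=> [s [s' [sK s'K sE]]]; exists s', s; split=> // y /=.
by rewrite -sE /= !s'K.
Qed.

Lemma dyn_equiv_trans (S T U : Type) (f : S -> S) (g : T -> T) (h : U -> U) :
  dyn_equiv f g -> dyn_equiv g h -> dyn_equiv f h.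
Proof.
move=> [s [s' [sK s'K sE]]] [t [t' [tK t'K tE]]].
exists (t \o s), (s' \o t'); split; [exact: can_comp|exact: can_comp|move=> x /=].
by rewrite -sE /= -tE.
Qed.

Definition dyn_equivb (T : finType) : rel {ffun T -> T} :=
  fun f g => `[< dyn_equiv f g >].

(* equivalence_partition only yields the equivalence classes when the relation
   is an equivalence. *)
Lemma dyn_equivb_equivalence (T : finType) : equivalence_rel (@dyn_equivb T).
Proof.
move=> f g h; split; first by apply/asboolP/dyn_equiv_refl.
move=> /asboolP fg; apply/asboolP/asboolP; last exact: dyn_equiv_trans.
by apply: dyn_equiv_trans; apply: dyn_equiv_sym.
Qed.

Definition dyn_classes (T : finType) (A : {set {ffun T -> T}}) :
    {set {set {ffun T -> T}}} :=
  equivalence_partition (@dyn_equivb T) A.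

Definition affine_map (F : finFieldType) (a b : F) : {ffun F -> F} :=
  [ffun x => a * x + b].

Definition affine_systems (F : finFieldType) : {set {ffun F -> F}} :=
  [set affine_map a b | a in [set~ 0], b in [set: F]].

(* Main.v *)
(* Dynamical equivalence preserves the existence of a fixed point and the
   exponents m with f^m = id.  The maps without fixed point are the nontrivial
   translations, all conjugate by scaling; the other maps are conjugate by a
   translation to some x |-> u x.  If u and v have the same order, then
   v = u^m for some m that can be chosen coprime to q - 1, and the permutation
   x |-> x^m conjugates x |-> u x to x |-> v x.  So the classes correspond to
   the orders of elements of the cyclic group F^*, plus the class of
   translations. *)

Require Import Defs.
From mathcomp Require Import all_boot all_algebra.
From mathcomp Require Import boolp.
From mathcomp Require Import fingroup cyclic finfield.

Set Implicit Arguments.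
Unset Strict Implicit.
Unset Printing Implicit Defensive.

Import GRing.Theory.

(** * Counting equivalence classes by labels *)

Lemma size_undup_map_eq (X A B : eqType) (f : X -> A) (g : X -> B)
    (s : seq X) :
    (forall x y, (f x == f y) = (g x == g y)) ->
  size (undup (map f s)) = size (undup (map g s)).
Proof.
move=> fg; elim: s => //= x s IHs.
have -> : (f x \in map f s) = (g x \in map g s).
  by elim: s {IHs} => //= y s IHs; rewrite !inE fg IHs.
by case: ifP => //= _; rewrite IHs.
Qed.

(** Two parameters give the same class exactly when their labels agree. Labels live on [X], so they
    can be read off from the coefficients of a map. *)
Lemma card_equivalence_partition_label (X T : finType) (R : rel T)
    (phi : X -> T) (lab : X -> nat) :
    equivalence_rel R ->
    (forall x y, R (phi x) (phi y) = (lab x == lab y)) ->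
  #|equivalence_partition R (phi @: setT)|
    = size (undup [seq lab x | x <- enum X]).
Proof.
move=> Req Rlab; pose cls x := [set t in phi @: setT | R (phi x) t].
have -> : equivalence_partition R (phi @: setT) = [set:: map cls (enum X)].
  apply/setP=> B; rewrite inE; apply/imsetP/mapP.
    by case=> _ /imsetP[x _ ->] ->; exists x; rewrite ?mem_enum.
  by case=> x _ ->; exists (phi x); rewrite ?imset_f.
have -> : #|[set:: map cls (enum X)]| = size (undup (map cls (enum X))).
  rewrite -(card_uniqP (undup_uniq _)); apply: eq_card => B.
  by rewrite inE mem_undup.
apply: size_undup_map_eq => x y; rewrite -Rlab.
apply/eqP/idP=> [exy | Rxy].
  have [Ryy _] := Req (phi y) (phi y) (phi y).
  have : phi y \in cls y by rewrite inE imset_f ?Ryy.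
  by rewrite -exy inE => /andP[].
apply/setP=> t; rewrite !inE; congr andb.
by have [_ ->] := Req (phi x) (phi y) t.
Qed.

Lemma coprime_lift (d n m : nat) : 0 < n -> 0 < m -> coprime d m ->
  exists k, coprime n (k * d + m).
Proof.
(* A prime r | n divides exactly one of m and t * d: if r | m then r divides
   neither t nor d, and otherwise r | t. *)
move=> n_gt0 m_gt0 cdm; pose t := n`_(\pi(m)^'); exists t.
apply: contraT => ncop.
have gcd_gt1 : 1 < gcdn n (t * d + m).
  by rewrite ltn_neqAle eq_sym ncop gcdn_gt0 n_gt0.
have r_pr := pdiv_prime gcd_gt1; set r := pdiv _ in r_pr.
have /andP[r_n r_tdm] : (r %| n) && (r %| t * d + m).
  by rewrite -dvdn_gcd pdiv_dvd.
have r_t : (r %| t) = ~~ (r %| m).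
  have: (r \in primes t) = ~~ (r \in primes m).
    rewrite primes_part mem_filter [r \in primes n]mem_primes.
    by rewrite r_pr n_gt0 r_n !andbT.
  by rewrite !mem_primes r_pr m_gt0 [0 < t]part_gt0.
case: (boolP (r %| m)) => r_m; last first.
  have r_td : r %| t * d by rewrite dvdn_mulr // r_t.
  by move: r_tdm; rewrite dvdn_addr // (negPf r_m).
move: r_tdm; rewrite dvdn_addl // Euclid_dvdM // r_t r_m /= => r_d.
have : r %| gcdn d m by rewrite dvdn_gcd r_d.
by rewrite (eqP cdm) dvdn1 => /eqP r1; move: r_pr; rewrite r1.
Qed.

Local Open Scope ring_scope.

(** * Invariants of dynamical equivalence *)

Lemma dyn_equiv_fixpoint (S T : Type) (f : S -> S) (g : T -> T) :
  dyn_equiv f g -> (exists x, f x = x) -> exists y, g y = y.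
Proof.
by move=> [s [s' [sK s'K sE]]] [x fx]; exists (s x); rewrite -{2}fx -sE /= s'K.
Qed.

Lemma dyn_equiv_iter_id (S T : Type) (f : S -> S) (g : T -> T) (m : nat) :
  dyn_equiv f g -> iter m f =1 id -> iter m g =1 id.
Proof.
move=> [s [s' [sK s'K sE]]] fm y.
have sfm x : s (iter m f x) = iter m g (s x).
  by elim: m {fm} => //= m <-; rewrite -sE /= s'K.
by rewrite -[y]s'K -sfm fm.
Qed.

(** * Affine maps over a finite field *)

Section AffineMaps.

Variable F : finFieldType.
Implicit Types (a b c x : F) (u v : {unit F}).

Lemma dyn_equiv_affine_fixpoint a b c :
  a * c + b = c -> dyn_equiv (affine_map a b) (affine_map a 0).
Proof.
move=> fix_c; exists (fun x => x - c), (fun x => x + c).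
split=> [x | x | x /=]; rewrite ?subrK ?addrK // !ffunE.
by rewrite addr0 mulrBr -addrA -{2}fix_c addKr.
Qed.

Lemma dyn_equiv_translation b :
  b != 0 -> dyn_equiv (affine_map 1 b) (affine_map (1 : F) 1).
Proof.
move=> b_neq0; exists (fun x => x / b), (fun x => x * b).
split=> [x | x | x /=]; rewrite ?divfK ?mulfK // !ffunE.
by rewrite !mul1r mulrDl divfK // mul1r.
Qed.

Lemma affine_fixpointP u b :
  (exists x : F, affine_map (val u) b x = x) <-> ~~ ((u == 1%g) && (b != 0)).
Proof.
split=> [[x]|].
  rewrite ffunE; apply: contraPN => /andP[/eqP -> b_neq0] /=.
  by rewrite mul1r => /eqP; rewrite -subr_eq0 addrC addKr (negPf b_neq0).
rewrite negb_and negbK => /orP[u_neq1 | /eqP ->]; last first.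
  by exists 0; rewrite ffunE mulr0 addr0.
have u1_neq0 : 1 - val u != 0 by rewrite subr_eq0 eq_sym.
(* The solution of x = u x + b. *)
exists (b / (1 - val u)); rewrite ffunE; apply: (mulIf u1_neq0).
rewrite mulrDl -!mulrA !mulVf // !mulr1.
by rewrite mulrBr mulr1 [b * _]mulrC addrC subrK.
Qed.

Lemma iter_linear_id u m :
  iter m (affine_map (val u) 0) =1 id <-> (#[u]%g %| m)%N.
Proof.
have iterE x : iter m (affine_map (val u) 0) x = val u ^+ m * x.
  elim: m => [|m IHm] /=; first by rewrite mul1r.
  by rewrite IHm ffunE addr0 mulrA exprS.
rewrite order_dvdn; split=> [um1 | /eqP um1 x].
  (* Evaluating the iterate at 1 yields u^m = 1. *)
  by apply/eqP/val_inj; rewrite FinRing.val_unitX -[LHS]mulr1 -iterE um1.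
by rewrite iterE -FinRing.val_unitX um1 mul1r.
Qed.

Lemma card_finField_pred_gt0 : (0 < #|F|.-1)%N.
Proof. by rewrite -subn1 subn_gt0 finNzRing_gt1. Qed.

(** Bezout gives k m = j (q - 1) + 1, and x^q = x removes the multiples of q - 1, also at x = 0. *)
Lemma expf_inverse (m : nat) : (0 < m)%N -> coprime #|F|.-1 m ->
  exists k : nat, forall x, (x ^+ m) ^+ k = x.
Proof.
move=> m_gt0; rewrite coprime_sym => cmq.
have F_gt1 : (1 < #|F|)%N := finNzRing_gt1 F.
case: (egcdnP #|F|.-1 m_gt0) => k j kmE _; exists k => x.
rewrite -exprM mulnC kmE (eqP cmq).
elim: j {kmE} => [|j IHj]; first by rewrite expr1.
by rewrite mulSn -addnA exprD IHj -exprSr prednK ?expf_card // ltnW.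
Qed.

(** In a cyclic group, elements of equal order generate the same subgroup, so v = u^m with m coprime
    to the order of u. Adding a multiple of that order makes m coprime to q - 1. *)
Lemma unit_expg_coprime u v : #[u]%g = #[v]%g ->
  exists2 m : nat, (0 < m)%N && coprime #|F|.-1 m & v = (u ^+ m)%g.
Proof.
move=> uv.
have cyc_uv : <[u]>%g = <[v]>%g.
  have cycF := field_unit_group_cyclic [set: {unit F}]%G.
  by apply/eqP; rewrite (eq_subG_cyclic cycF) ?subsetT //; apply/eqP.
have /cycleP[m vE] : v \in <[u]>%g by rewrite cyc_uv cycle_id.
(* The shift by [#[u]] ensures positivity: m may be 0 when u = 1. *)
have cum : coprime #[u]%g (#[u]%g + m).
  by rewrite /coprime gcdnDl -[_ == 1%N]generator_coprime -vE /generator cyc_uv.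
have F_gt0 := card_finField_pred_gt0.
have um_gt0 : (0 < #[u]%g + m)%N by rewrite ltn_addr.
have [k ck] := coprime_lift F_gt0 um_gt0 cum.
exists (k * #[u]%g + (#[u]%g + m))%N; first by rewrite ck ltn_addl.
by rewrite !expgD mulnC expgM expg_order expg1n !mul1g.
Qed.

Lemma dyn_equiv_linear u v :
  dyn_equiv (affine_map (val u) 0) (affine_map (val v) 0) <->
  #[u]%g = #[v]%g.
Proof.
(* The iterate of exponent [#[u']] is the identity for u', hence also for v'. *)
have dvd u' v' : dyn_equiv (affine_map (val u') 0) (affine_map (val v') 0) ->
    (#[v']%g %| #[u']%g)%N.
  by move=> uv; apply/iter_linear_id/(dyn_equiv_iter_id uv)/iter_linear_id.
split=> [uv | /unit_expg_coprime[m /andP[m_gt0 cm] ->]].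
  by apply/eqP; rewrite eqn_dvd !dvd //; apply: dyn_equiv_sym.
have [k mK] := expf_inverse m_gt0 cm.
exists (fun x => x ^+ m), (fun x => x ^+ k); split=> [//|x|x /=].
  by rewrite exprAC.
by rewrite !ffunE !addr0 FinRing.val_unitX -exprMn mK.
Qed.

(* No unit has order 0, which is left to label the nontrivial translations. *)
Definition affine_label (ub : {unit F} * F) : nat :=
  if (ub.1 == 1%g) && (ub.2 != 0) then 0 else #[ub.1]%g.

Lemma affine_label_eq0 u b :
  (affine_label (u, b) == 0)%N = (u == 1%g) && (b != 0).
Proof.
by rewrite /affine_label /=; case: ifP => // _; rewrite eqn0Ngt order_gt0.
Qed.

Lemma dyn_equiv_affine u v b c :
  dyn_equiv (affine_map (val u) b) (affine_map (val v) c) <->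
  affine_label (u, b) = affine_label (v, c).
Proof.
have [fu | Nfu] := boolP ((u == 1%g) && (b != 0)); last first.
  have [fv | Nfv] := boolP ((v == 1%g) && (c != 0)).
    (* Both sides are false: only the first map has a fixed point, and only the second label is
       0. *)
    split=> [uv | labE].
      have := dyn_equiv_fixpoint uv (proj2 (affine_fixpointP u b) Nfu).
      by move/affine_fixpointP; rewrite fv.
    by move: Nfu; rewrite -affine_label_eq0 labE affine_label_eq0 fv.
  rewrite /affine_label /= (negPf Nfu) (negPf Nfv) -dyn_equiv_linear.
  have [x fx] := proj2 (affine_fixpointP u b) Nfu.
  have [y fy] := proj2 (affine_fixpointP v c) Nfv.
  rewrite !ffunE in fx fy.
  have eu := dyn_equiv_affine_fixpoint fx.
  have ev := dyn_equiv_affine_fixpoint fy.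
  split=> uv.
    exact: dyn_equiv_trans (dyn_equiv_sym eu) (dyn_equiv_trans uv ev).
  exact: dyn_equiv_trans eu (dyn_equiv_trans uv (dyn_equiv_sym ev)).
have [fv | Nfv] := boolP ((v == 1%g) && (c != 0)).
  rewrite /affine_label /= fu fv; split=> // _.
  have [/andP[/eqP -> b0] /andP[/eqP -> c0]] := (fu, fv).
  apply: dyn_equiv_trans (dyn_equiv_translation b0) _.
  exact/dyn_equiv_sym/dyn_equiv_translation.
split=> [uv | labE].
  have := dyn_equiv_fixpoint (dyn_equiv_sym uv)
            (proj2 (affine_fixpointP v c) Nfv).
  by move/affine_fixpointP; rewrite fu.
by move: Nfv; rewrite -affine_label_eq0 -labE affine_label_eq0 fu.
Qed.

(** * Counting the labels *)

Lemma unit_order_divisors d : (d %| #|F|.-1)%N ->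
  exists u : {unit F}, #[u]%g = d.
Proof.
rewrite -card_finField_unit => /dvdnP[e cardE].
have /cyclicP[g gE] := field_unit_group_cyclic [set: {unit F}]%G.
have ordg : #[g]%g = (e * d)%N by rewrite orderE -gE cardE.
have e_gt0 : (0 < e)%N by move: (order_gt0 g); rewrite ordg muln_gt0 => /andP[].
(* A generator raised to the cofactor e = (q - 1) / d has order d. *)
by exists (g ^+ e)%g; rewrite orderXdiv ordg ?dvdn_mulr // mulKn.
Qed.

Lemma size_affine_labels :
  size (undup [seq affine_label ub | ub <- enum {: {unit F} * F}])
    = (size (divisors #|F|.-1)).+1.
Proof.
have F_gt0 := card_finField_pred_gt0.
rewrite -[RHS]/(size (0%N :: divisors #|F|.-1)); apply: perm_size.
apply: uniq_perm; rewrite ?undup_uniq //=.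
  (* The label 0 is not a divisor, because q - 1 is positive. *)
  by rewrite divisors_uniq -dvdn_divisors // dvd0n -lt0n F_gt0.
move=> d; rewrite mem_undup inE -dvdn_divisors //; apply/mapP/orP.
  case=> -[u b] _ ->; have [fu | Nfu] := boolP ((u == 1%g) && (b != 0)).
    by left; rewrite affine_label_eq0.
  right; rewrite /affine_label /= (negPf Nfu) -card_finField_unit.
  by rewrite order_dvdG ?inE.
case=> [/eqP -> | /unit_order_divisors[u <-]].
  by exists (1%g, 1); rewrite ?mem_enum // /affine_label /= eqxx oner_eq0.
by exists (u, 0); rewrite ?mem_enum // /affine_label /= eqxx andbF.
Qed.

(** Turns nonzero coefficients into units, whose group order the labels use. *)
Lemma affine_systemsE :
  affine_systems F =
    [set affine_map (val ub.1) ub.2 | ub in [set: {unit F} * F]].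
Proof.
apply/setP=> f; apply/imset2P/imsetP.
  case=> a b; rewrite !inE -unitfE => a_unit _ ->.
  by exists (FinRing.unit F a_unit, b).
case=> -[u b] _ ->; exists (val u) b => //.
by rewrite !inE -unitfE (valP u).
Qed.

End AffineMaps.

Local Close Scope ring_scope.

Theorem theorem3p4 (p k q : nat) (hp : prime p) (hk : 0 < k) (hq : q = p ^ k)
    (F : finFieldType) (hF : #|F| = q) :
  #|dyn_classes (affine_systems F)| = size (divisors (q - 1)) + 1.
Proof.
rewrite -hF subn1 addn1 -size_affine_labels /dyn_classes affine_systemsE.
apply: card_equivalence_partition_label; first exact: dyn_equivb_equivalence.
by move=> [u b] [v c]; apply/asboolP/eqP=> /dyn_equiv_affine.
Qed.
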